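(* Let $\mathcal X\to X\leftarrow Y$ be a crepant resolution diagram of toric Calabi--Yau threefolds for which the Coates--Iritani--Tseng/Ruan form of the closed crepant resolution conjecture holds, with symplectic isomorphism $\mathbb U=\mathbb U_\rho^{\mathcal X,Y}:\mathcal H_{\mathcal X}\to\mathcal H_Y$, and identify quantum parameters in $\Delta_{\mathcal X}$ and $\Delta_Y$ via $\mathcal I_\rho^{\mathcal X,Y}$. Let $L$ be an Aganagic--Vafa boundary condition on $\mathcal X$, and denote also by $L$ its transform on $Y$. Let $\mathbb O:\mathcal H_{\mathcal X}\to\mathcal H_Y$ be the $\mathbb C((z^{-1}))$-linear transformation with $\overline{\mathcal D}_Y^+\circ\mathbb U=\mathbb O\circ\overline{\mathcal D}_{\mathcal X}^+$. Then, upon analytic continuation of the potential of $Y$, $$\mathfrak h_Y^{1/z}\,\mathbb F^{\rm disk}_{L,Y}\big|_{\Delta_Y}=\mathfrak h_{\mathcal X}^{1/z}\,\mathbb O\circ\mathbb F^{\rm disk}_{L,\mathcal X}\big|_{\Delta_{\mathcal X}}.$$ Assume further that $\mathcal X$ satisfies the Hard Lefschetz condition and identify cohomologies via the affine linear change of variables $\widehat{\mathcal I}_\rho^{\mathcal X,Y}$. Then $$\mathbb F^{\rm disk}_{L,Y}=\mathbb O\circ\mathbb F^{\rm disk}_{L,\mathcal X}.$$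
   Context: **Targets.** $\mathcal X$ is a three-dimensional toric Calabi--Yau orbifold (smooth Deligne--Mumford stack, generically trivial stabilizers) with semi-projective coarse space $X$, and $Y\to X$ is a toric crepant resolution. $T\simeq\mathbb C^*$ acts on both, equivariantly for $Y\to X$, trivially on the canonical bundles, and with zero-dimensional fixed loci. For $\mathcal Z=\mathcal X,Y$: $H(\mathcal Z)$ is $T$-equivariant Chen--Ruan cohomology (localized at the equivariant parameter $\nu$), with equivariant orbifold Poincaré pairing $\eta$; $\mathcal H_{\mathcal Z}=H(\mathcal Z)((z^{-1}))$ with symplectic form ${\rm Res}_{z=0}\eta(f(-z),g(z))$; $\Delta_{\mathcal Z}\subset H(\mathcal Z)$ is the submodule spanned by equivariant lifts of classes of Chen--Ruan degree $\le2$. $\mathcal X$ is Hard Lefschetz if ${\rm age}(\theta)={\rm age}({\rm inv}^*\theta)$ for all $\theta\in H(\mathcal X)$, inv being the involution of the inertia stack. **$J$-function.** $J^{\mathcal Z}(\tau,z)=z\mathbf 1+\tau+\sum_\alpha\phi^\alpha\langle\langle\frac{\phi_\alpha}{z-\psi}\rangle\rangle_{0,1}(\tau)$, where $\langle\langle\cdot\rangle\rangle_{0,1}(\tau)=\sum_{m,\beta}\frac1{m!}\langle\,\cdot\,,\tau,\dots,\tau\rangle_{0,1+m,\beta}$ are $T$-equivariant Gromov--Witten correlators; $\mathcal L_{\mathcal Z}\subset\mathcal H_{\mathcal Z}$ is Givental's Lagrangian cone, the graph of the differential of the genus zero descendent potential. **Scaling factors.** Write $\mathcal Z$ as a GIT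 quotient of $\mathbb C^{3+n_{\mathcal Z}}$ by $(\mathbb C^* )^{n_{\mathcal Z}}$; let $\Xi_i$ be the equivariant class of the $i$-th coordinate hyperplane, $D_i(\beta)=\int_\beta\Xi_i$, $\zeta_i^{(0)}$ the coefficient of $\mathbf 1_{\mathcal Z}$ in $\Xi_i$ (in the chosen basis), $J_\beta^\pm=\{j:\pm D_j(\beta)>0\}$. Then $$\mathfrak h_{\mathcal Z}=\exp\Big[\sum_\beta\mathfrak a^\beta\,\frac{\prod_{j\in J_\beta^-}(-1)^{D_j(\beta)}|D_j(\beta)|!}{\prod_{j\in J_\beta^+}D_j(\beta)!}\sum_{k\in J_\beta^-}\frac{-\zeta_k^{(0)}}{D_k(\beta)}\Big],$$ with $\mathfrak a=\mathfrak a(\tau_{0,2})$ the inverse mirror map (so that $\mathfrak h_{\mathcal Z}^{1/z}$ times the small $J$-function is the $I$-function). **Closed CRC hypothesis.** There is a $\mathbb C((z^{-1}))$-linear symplectic isomorphism $\mathbb U$ with $\mathbb U(\mathcal L_{\mathcal X})=\mathcal L_Y$ after analytic continuation of small quantum parameters along a path $\rho$. The analytic identification $\mathcal I=\mathcal I^{\mathcal X,Y}_\rho:\Delta_{\mathcal X}\to\Delta_Y$ of quantum parameters (between neighborhoods of the projections of the large radius points) is the one for which $\mathfrak h_Y^{1/z}\widetilde J^Y(\mathcal I(\tau),z)=\mathbb U\,\mathfrak h_{\mathcal X}^{1/z}J^{\mathcal X}(\tau,z)$ on $\Delta_{\mathcal X}$, $\widetilde J^Y$ being the continued $J$-function; it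 is read off from the non-equivariant limits of $\mathbb U$ and of the $J$-functions. In the Hard Lefschetz case $\mathfrak h_{\mathcal X}=\mathfrak h_Y$, $\mathcal I$ extends to an affine linear isomorphism $\widehat{\mathcal I}:H(\mathcal X)\to H(Y)$, and $\widetilde J^Y(\widehat{\mathcal I}(\tau),z)=\mathbb U J^{\mathcal X}(\tau,z)$ on all of $H(\mathcal X)$. **Disk endomorphism.** An Aganagic--Vafa brane lies on a torus invariant line. Let $p$ be an adjacent fixed point with local model $[\mathbb C^3/\mathbb Z_{r}]$, representation weights $(m_1,m_2,m_3)$ and torus weights $(w_1,w_2,w_3)$, $\sum w_i=0$, the brane being on the first axis. With $\mathbf 1_{p,k}$ the fixed-point class at $p$ in the sector $k\in\{1,\dots,r\}$ ($k=r$ untwisted), $\mathbf 1_p^k$ the $\eta$-dual basis, $f_i=\langle km_i/r\rangle$ and $\overline\Gamma^k=z^{-(f_1+f_2+f_3)}\prod_{i=1}^3\Gamma(1-f_i+w_i/z)$, $$\overline{\mathcal D}^+_{\mathcal Z}(\mathbf 1_{p,k})=\frac{\pi}{w_1r\sin(\pi(f_3-w_3/z))}\,\frac1{\overline\Gamma^k}\,\mathbf 1_p^k,$$ extended by zero on classes at fixed points not adjacent to the brane. For negative orientation the indices 2 and 3 are exchanged; for several branes the endomorphisms are added. The winding neutral disk potential is $\mathbb F^{\rm disk}_{L,\mathcal Z}(\tau,z)=\overline{\mathcal D}^+_{\mathcal Z}\circ J^{\mathcal Z}(\tau,z)$. *)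

(* Defs.v *)
From HB Require Import structures.
From mathcomp Require Import all_boot all_order all_algebra finmap.
From mathcomp Require Import all_classical all_reals all_analysis.
From mathcomp.analysis.showcase Require summability.
From mathcomp Require Import complex zify.

Set Implicit Arguments.
Unset Strict Implicit.
Unset Printing Implicit Defensive.
Import Order.TTheory GRing.Theory Num.Theory numFieldNormedType.Exports.
Local Open Scope classical_set_scope.
Local Open Scope ring_scope.

(** * Laurent series in 1/z

   An element of K((z^-1)) is its coefficient function n |-> [z^n], which
   vanishes for all large n. *)

Definition bounded_above (K : nmodType) (f : int -> K) : Prop :=
  exists N : int, forall n : int, N < n -> f n = 0.

Record laurent (K : nmodType) := Laurent {
  coef :> int -> K;
  coefP : `[< bounded_above coef >] }.

Arguments coef {K} l n.

HB.instance Definition _ (K : nmodType) := [isSub for @coef K].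
HB.instance Definition _ (K : nmodType) := gen_eqMixin (laurent K).
HB.instance Definition _ (K : nmodType) := gen_choiceMixin (laurent K).

Section LaurentRing.
Variable K : comNzRingType.
Implicit Types f g h : laurent K.

Definition top_le (a : int) (f : int -> K) := forall n, a < n -> f n = 0.

Lemma laurent_top f : exists a, top_le a f.
Proof. by have /asboolP := coefP f. Qed.

Lemma laurentP f g : (forall n, f n = g n) -> f = g.
Proof. by move=> e; apply: val_inj; apply/funext. Qed.

Lemma laurent_of_subproof (N : int) (f : int -> K) :
  `[< bounded_above (fun n => if n <= N then f n else 0) >].
Proof. by apply/asboolP; exists N => n lt; rewrite leNgt lt. Qed.

(* \sum_(n <= N) (f n) z^n *)
Definition laurent_of (N : int) (f : int -> K) : laurent K :=
  Laurent (laurent_of_subproof N f).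

Definition laurent_const (c : K) : laurent K :=
  laurent_of 0 (fun n => if n == 0 then c else 0).

Lemma add_subproof f g : `[< bounded_above (fun n => f n + g n) >].
Proof.
have [a fa] := laurent_top f; have [b gb] := laurent_top g.
apply/asboolP; exists (Num.max a b) => n; rewrite gt_max => /andP[an bn].
by rewrite fa// gb// addr0.
Qed.

Lemma opp_subproof f : `[< bounded_above (fun n => - f n) >].
Proof.
by have [a fa] := laurent_top f; apply/asboolP; exists a => n an; rewrite fa// oppr0.
Qed.

Lemma flip_subproof f :
  `[< bounded_above (fun n : int => if odd `|n|%N then - f n else f n) >].
Proof.
have [a fa] := laurent_top f; apply/asboolP; exists a => n an.
by rewrite fa// oppr0 if_same.
Qed.

Definition laurent_add f g := Laurent (add_subproof f g).
Definition laurent_opp f := Laurent (opp_subproof f).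
(* f(-z) *)
Definition laurent_flip f := Laurent (flip_subproof f).
Definition laurent_zero : laurent K := laurent_const 0.

Lemma laurent_addA : associative laurent_add.
Proof. by move=> f g h; apply: laurentP => n /=; rewrite addrA. Qed.
Lemma laurent_addC : commutative laurent_add.
Proof. by move=> f g; apply: laurentP => n /=; rewrite addrC. Qed.
Lemma laurent_add0 : left_id laurent_zero laurent_add.
Proof. by move=> f; apply: laurentP => n /=; rewrite !if_same add0r. Qed.
Lemma laurent_addN : left_inverse laurent_zero laurent_opp laurent_add.
Proof. by move=> f; apply: laurentP => n /=; rewrite !if_same addNr. Qed.

HB.instance Definition _ := GRing.isZmodule.Build (laurent K)
  laurent_addA laurent_addC laurent_add0 laurent_addN.

(* The sum has finite support. *)
Definition mul_coef f g (n : int) : K := \sum_(i \in [set: int]) f i * g (n - i).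

Definition chunk (a : int) (f : int -> K) (m : nat) : {poly K} :=
  \poly_(i < m) f (a - i%:Z).

Lemma mul_coefE f g a b (m k : nat) : top_le a f -> top_le b g -> (m < k)%N ->
  mul_coef f g (a + b - m%:Z) = (chunk a f k * chunk b g k)`_m.
Proof.
move=> fa gb mk; rewrite coefM /mul_coef.
pose F i := f i * g (a + b - m%:Z - i).
have supp i : F i != 0 -> a - m%:Z <= i <= a.
  move=> Fi; apply/andP; split; rewrite leNgt; apply/negP => lti; move: Fi.
    by rewrite /F (gb (a + b - m%:Z - i)) ?mulr0 ?eqxx//; lia.
  by rewrite /F fa ?mul0r ?eqxx.
rewrite (fsbigE [seq a - (nat_of_ord i)%:Z | i : 'I_m.+1 <- enum 'I_m.+1])//; last first.
- move=> i _ /negP ir; apply/eqP/negPn/negP => /supp /andP[i1 i2]; apply: ir.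
  apply/mapP; exists (inord `|a - i|%N); first by rewrite mem_enum.
  by rewrite inordK; lia.
- rewrite map_inj_uniq ?enum_uniq// => i j ij; apply: val_inj => /=; lia.
rewrite big_map big_enum_cond /=; apply: eq_big => [i|i _]; first by rewrite in_setT.
rewrite !coef_poly (leq_ltn_trans (leq_ord i) mk).
rewrite (leq_ltn_trans (leq_subr _ _) mk); congr (_ * g _).
by have := ltn_ord i; lia.
Qed.

Lemma mul_coef_top f g a b : top_le a f -> top_le b g -> top_le (a + b) (mul_coef f g).
Proof.
move=> fa gb n abn; rewrite /mul_coef fsbig1// => i _.
have [ai|ia] := ltP a i; first by rewrite fa// mul0r.
by rewrite (gb (n - i)) ?mulr0//; lia.
Qed.

Lemma mul_subproof f g : `[< bounded_above (mul_coef f g) >].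
Proof.
have [a fa] := laurent_top f; have [b gb] := laurent_top g.
by apply/asboolP; exists (a + b); apply: mul_coef_top.
Qed.

Definition laurent_mul f g := Laurent (mul_subproof f g).
Definition laurent_one : laurent K := laurent_const 1.

Lemma chunk_mul f g a b (m k : nat) : top_le a f -> top_le b g -> (m < k)%N ->
  (chunk (a + b) (mul_coef f g) k)`_m = (chunk a f k * chunk b g k)`_m.
Proof. by move=> fa gb mk; rewrite coef_poly mk (mul_coefE fa gb mk). Qed.

Lemma top_or_sub (a n : int) : a < n \/ exists m : nat, n = a - m%:Z.
Proof. by have [|na] := ltP a n; [left | right; exists `|a - n|%N; lia]. Qed.

Lemma coefM_trunc (p p' q : {poly K}) m :
  (forall i, (i <= m)%N -> p`_i = p'`_i) -> (p * q)`_m = (p' * q)`_m.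
Proof. by move=> e; rewrite !coefM; apply: eq_bigr => i _; rewrite e// -ltnS. Qed.

Lemma laurent_mulC : commutative laurent_mul.
Proof.
move=> f g; apply: laurentP => n /=.
have [a fa] := laurent_top f; have [b gb] := laurent_top g.
have [lt|[m ->]] := top_or_sub (a + b) n.
  by rewrite (mul_coef_top fa gb)// (mul_coef_top gb fa)// addrC.
by rewrite (mul_coefE fa gb (ltnSn m)) [a + b]addrC (mul_coefE gb fa (ltnSn m)) mulrC.
Qed.

Lemma laurent_mulA : associative laurent_mul.
Proof.
move=> f g h; apply: laurentP => n /=.
have [a fa] := laurent_top f; have [b gb] := laurent_top g; have [c hc] := laurent_top h.
have fg := mul_coef_top fa gb; have gh := mul_coef_top gb hc.
have [lt|[m ->]] := top_or_sub (a + b + c) n.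
  by rewrite (mul_coef_top (f := laurent_mul f g) fg hc)// (mul_coef_top (g := laurent_mul g h) fa gh)// addrA.
have mm := ltnSn m.
rewrite (mul_coefE (f := laurent_mul f g) fg hc mm) -[a + b + c]addrA.
rewrite (mul_coefE (g := laurent_mul g h) fa gh mm).
rewrite (@coefM_trunc (chunk (a + b) (laurent_mul f g) m.+1)
  (chunk a f m.+1 * chunk b g m.+1)); last by move=> i im; apply: chunk_mul.
rewrite -mulrA mulrC [RHS](congr1 (fun q : {poly K} => q`_m) (mulrC _ _)).
by apply: coefM_trunc => i im; apply: chunk_mul.
Qed.

Lemma laurent_mul1 : left_id laurent_one laurent_mul.
Proof.
move=> f; apply: laurentP => n /=.
rewrite /mul_coef (fsbigE [:: 0 : int])//=; last first.
  by move=> i _; rewrite inE => /negbTE ->; rewrite if_same mul0r.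
by rewrite big_cons big_nil in_setT /= mul1r subr0 addr0.
Qed.

Lemma laurent_mulDl : left_distributive laurent_mul laurent_add.
Proof.
move=> f g h; apply: laurentP => n /=.
have [a fa] := laurent_top f; have [b gb] := laurent_top g; have [c hc] := laurent_top h.
pose d := Num.max a b.
have fd : top_le d f by move=> i; rewrite gt_max => /andP[/fa].
have gd : top_le d g by move=> i; rewrite gt_max => /andP[_ /gb].
have fgd : top_le d (laurent_add f g) by move=> i di /=; rewrite fd// gd// addr0.
have [lt|[m ->]] := top_or_sub (d + c) n.
  by rewrite (mul_coef_top fgd hc)// (mul_coef_top fd hc)// (mul_coef_top gd hc)// addr0.
rewrite (mul_coefE fgd hc (ltnSn m)) (mul_coefE fd hc (ltnSn m)) (mul_coefE gd hc (ltnSn m)).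
rewrite -coefD -mulrDl; apply: coefM_trunc => i im.
by rewrite coefD !coef_poly ltnS im.
Qed.

Lemma laurent_one_neq0 : laurent_one != 0.
Proof.
apply/eqP => /(congr1 (fun f : laurent K => f 0)) /= /eqP.
by rewrite /= oner_eq0.
Qed.

HB.instance Definition _ := GRing.Zmodule_isComNzRing.Build (laurent K)
  laurent_mulA laurent_mulC laurent_mul1 laurent_mulDl laurent_one_neq0.

End LaurentRing.

(** * Complex analysis *)

Definition Cx (R : realType) : numClosedFieldType := R[i].

Section Analysis.
Variable R : realType.
Local Notation C := (Cx R).

Definition toC (x : R) : C := Complex x 0.
Definition reC (z : C) : R := complex.Re z.

Definition cexp (z : C) : C :=
  toC (expR (complex.Re z)) * Complex (cos (complex.Im z)) (sin (complex.Im z)).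
Definition csin (z : C) : C := (cexp ('i * z) - cexp (- ('i * z))) / (2 * 'i).

(* Gauss: 1 / Gamma(x) = lim_n x (x + 1) ... (x + n) / (n! n^x), entire in x *)
Definition rGamma (x : C) : C :=
  lim ((fun n : nat => (\prod_(k < n.+1) (x + k%:R)) /
         (n`!%:R * cexp (x * toC (ln n%:R)))) @ \oo).
Definition cGamma (x : C) : C := (rGamma x)^-1.

(* Unconditional (equivalently absolute) summation over a countable family. *)
Definition sums_to (I : choiceType) (f : I -> C) (l : C) : Prop :=
  summability.partial_sum f @ summability.totally --> l.
Definition tsummable (I : choiceType) (f : I -> C) : Prop := exists l, sums_to f l.
Definition tsum (I : choiceType) (f : I -> C) : C :=
  lim (summability.partial_sum f @ summability.totally).

(* The Laurent expansion at z = oo of a function of z. *)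
Definition is_expansion (F : C -> C) (s : laurent C) : Prop :=
  exists M : R, forall z : C, toC M < `|z| -> sums_to (fun n : int => s n * z ^ n) (F z).
Definition expansion (F : C -> C) : laurent C := xget 0 [set s | is_expansion F s].

Definition holomorphic_on (V W : normedModType C) (A : set V) (f : V -> W) : Prop :=
  forall x, A x -> differentiable f x.

Definition is_path (V : normedModType C) (rho : R -> V) : Prop :=
  {within `[0, 1], continuous rho}.

(* g, on the connected open set W, is the analytic continuation along rho of
   the germ of f at rho 0; F r is the continued germ at rho r. *)
Definition continuation (V : normedModType C) (rho : R -> V) (f : V -> C)
    (W : set V) (g : V -> C) : Prop :=
  [/\ open W, connected W, W (rho 1), holomorphic_on W (g : V -> C^o)
    & exists F : R -> V -> C,
      [/\ forall r : R, 0 <= r <= 1 ->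
            \forall y \near rho r, differentiable (F r : V -> C^o) y,
          forall r : R, 0 <= r <= 1 -> \forall r' \near r, 0 <= r' <= 1 ->
            \forall y \near rho r', F r' y = F r y,
          \forall y \near rho 0, F 0 y = f y
        & \forall y \near rho 1, F 1 y = g y]].

End Analysis.

(** * Toric Calabi-Yau orbifolds *)

(* Rays in the lattice N = Z^3 and, for each torus fixed point (maximal cone),
   the ordered triple of rays spanning that cone. *)
Record stacky_fan := StackyFan {
  nray : nat;
  ray : 'I_nray -> 'rV[int]_3;
  npt : nat;
  cone : 'I_npt -> 'I_3 -> 'I_nray }.

Section Fan.
Variable Z : stacky_fan.
Implicit Types (p : 'I_(npt Z)) (i : 'I_(nray Z)) (j : 'I_3).

Definition qray i : 'rV[rat]_3 := map_mx intr (ray i).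
Definition cone_mx p : 'M[int]_3 := \matrix_j ray (cone p j).
Definition verts p : {set 'I_(nray Z)} := [set cone p j | j : 'I_3].

(* the order of the isotropy group N / <rays of the cone> *)
Definition isotropy p : nat := `|\det (cone_mx p)|%N.

Definition in_cone (A : {set 'I_(nray Z)}) (x : 'rV[rat]_3) : Prop :=
  exists c : 'rV[rat]_(nray Z),
    [/\ forall i, 0 <= c 0 i, forall i, i \notin A -> c 0 i = 0
      & x = \sum_i c 0 i *: qray i].

Definition support (x : 'rV[rat]_3) : Prop := exists p, in_cone (verts p) x.

(* The stacky fan of a three-dimensional toric orbifold with semi-projective
   coarse space (simplicial fan with full-dimensional convex support and a
   strictly convex support function) and trivial canonical bundle (all rays at
   height one for h).  Each cone is listed with positive orientation. *)
Definition toric_CY3 (h : 'cV[int]_3) : Prop :=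
  [/\ (0 < npt Z)%N,
      [/\ injective (@ray Z), injective verts & forall i, exists p, i \in verts p],
      forall p, 0 < \det (cone_mx p),
      [/\ forall p q x, in_cone (verts p) x -> in_cone (verts q) x ->
            in_cone (verts p :&: verts q) x,
          forall x, in_cone [set: 'I_(nray Z)]%SET x -> support x
        & exists phi : 'I_(nray Z) -> rat, forall p, exists m : 'cV[rat]_3,
            forall i, if i \in verts p then (qray i *m m) 0 0 = phi i
                      else (qray i *m m) 0 0 < phi i]
    & forall i, (ray i *m h) 0 0 = 1].

(* Weights (in units of the equivariant parameter) at p of the C^* with
   cocharacter u: the coordinates of u in the basis of rays of the cone. *)
Definition qweight (u : 'rV[int]_3) p : 'rV[rat]_3 :=
  map_mx intr u *m invmx (map_mx intr (cone_mx p)).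

(* The fixed locus of u is zero-dimensional. *)
Definition isolated_fixed (u : 'rV[int]_3) : Prop := forall p j, qweight u p 0 j != 0.

(* Fixed points of the inertia stack: pairs (p, g) with g in the isotropy group
   of p, written as the box element \sum_j (a_j / r) ray_j of the cone. *)
Definition is_box (s : {p : 'I_(npt Z) & {ffun 'I_3 -> 'I_(isotropy p)}}) : bool :=
  [forall k : 'I_3,
    ((isotropy (tag s))%:Z %| \sum_j (tagged s j)%:Z * ray (cone (tag s) j) 0 k)%Z].

Definition sector : finType := {s : {p : 'I_(npt Z) & {ffun 'I_3 -> 'I_(isotropy p)}} | is_box s}.

Implicit Types s : sector.
Definition pt s : 'I_(npt Z) := tag (val s).
Definition frac s j : rat := (tagged (val s) j)%:R / (isotropy (pt s))%:R.
Definition age s : rat := \sum_j frac s j.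
Definition boxvec s : 'rV[rat]_3 := \sum_j frac s j *: qray (cone (pt s) j).
Definition untwisted s : bool := [forall j, frac s j == 0].
Definition is_inv s s' : bool :=
  (pt s == pt s') && [forall j, frac s j + frac s' j \is a Num.int].

Definition hard_lefschetz : Prop := forall s s', is_inv s s' -> age s = age s'.

(* Age one twisted sectors of the inertia stack, each represented by one of its
   fixed points. *)
Definition twist : finType :=
  {s : sector | (age s == 1) && ([pick s' | boxvec s' == boxvec s] == Some s)}.

(* Curve classes are relations among rays: b 0 i is the intersection with the
   i-th toric divisor.  The Mori cone is generated by the classes of the
   compact torus invariant curves, one for each wall. *)
Definition is_relation (b : 'rV[rat]_(nray Z)) : Prop := \sum_i b 0 i *: qray i = 0.

Definition wall_class (b : 'rV[rat]_(nray Z)) : Prop :=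
  is_relation b /\ exists p q,
    [/\ #|verts p :&: verts q| = 2%N,
        forall i, i \notin verts p :|: verts q -> b 0 i = 0
      & forall i, i \in (verts p :\: verts q) :|: (verts q :\: verts p) -> 0 < b 0 i].

Definition effective (b : 'rV[rat]_(nray Z)) : Prop :=
  exists c : seq 'rV[rat]_(nray Z),
    (forall x, x \in c -> wall_class x) /\ b = \sum_(x <- c) x.

End Fan.

(* X -> |X| <- Y: the fan of Y refines that of X, with the same support and the
   same height function h (crepancy), and Y is smooth. *)
Definition crepant_resolution (h : 'cV[int]_3) (X Y : stacky_fan) : Prop :=
  [/\ toric_CY3 X h, toric_CY3 Y h, forall q : 'I_(npt Y), isotropy q = 1%N,
      forall q : 'I_(npt Y), exists p : 'I_(npt X),
        forall j, in_cone (verts p) (qray (cone q j))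
    & forall x, support X x -> support Y x].

(** * Equivariant Chen-Ruan cohomology and Givental's space *)

Section Cohomology.
Variables (R : realType) (Z : stacky_fan) (u : 'rV[int]_3) (nu : Cx R).
Local Notation C := (Cx R).
Implicit Types (p : 'I_(npt Z)) (i : 'I_(nray Z)) (j : 'I_3) (s : sector Z).

(* Localized equivariant Chen-Ruan cohomology at a nonzero value nu of the
   equivariant parameter, in the basis of fixed-point classes. *)
Definition coh := 'rV[C]_#|sector Z|.
Definition givental := 'rV[laurent C]_#|sector Z|.

Definition weight p j : C := ratr (qweight u p 0 j) * nu.
Definition fpclass s : coh := delta_mx 0 (enum_rank s).
Definition coh_of (v : sector Z -> C) : coh := \row_k v (enum_val k).

(* \int of fpclass s * fpclass s': by localization only the directions fixed by
   the box element (frac s j = 0) contribute to the Euler class. *)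
Definition gram s s' : C :=
  if is_inv s s' then
    ((isotropy (pt s))%:R * \prod_(j | frac s j == 0) weight (pt s) j)^-1
  else 0.
Definition pairing (v w : coh) : C :=
  \sum_s \sum_s' gram s s' * v 0 (enum_rank s) * w 0 (enum_rank s').
Definition gram_mx : 'M[C]_#|sector Z| := \matrix_(k, l) gram (enum_val k) (enum_val l).
Definition dual s : coh := row (enum_rank s) (invmx gram_mx).

Definition unit_class : coh := coh_of (fun s => (untwisted s)%:R).
Definition divisor_at p i : C := \sum_(j | cone p j == i) weight p j.
Definition divisor i : coh :=
  coh_of (fun s => if untwisted s then divisor_at (pt s) i else 0).
Definition twisted_class (e : twist Z) : coh :=
  coh_of (fun s => (boxvec s == boxvec (val e))%:R).
Definition mul_divisor i (v : coh) : coh :=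
  coh_of (fun s => divisor_at (pt s) i * v 0 (enum_rank s)).

(* Delta_Z *)
Definition small_space : {vspace coh} :=
  << unit_class :: [seq divisor i | i <- enum 'I_(nray Z)]
       ++ [seq twisted_class e | e <- enum (twist Z)] >>%VS.

Definition omega (f g : givental) : C :=
  (\sum_s \sum_s' laurent_const (gram s s')
     * laurent_flip (f 0 (enum_rank s)) * g 0 (enum_rank s')) (- 1).

End Cohomology.

(** * Genus zero Gromov-Witten theory *)

Section Correlators.
Variables (R : realType) (Z : stacky_fan) (u : 'rV[int]_3) (nu : Cx R).
Local Notation C := (Cx R).
Local Notation H := (coh R Z).
Local Notation curve := 'rV[rat]_(nray Z).

(* corr [:: (k1, v1); ...; (kn, vn)] b is <v1 psi^k1, ..., vn psi^kn>_{0,n,b};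
   it is extended by zero to rational relations b that are not curve classes. *)
Definition correlators := seq (nat * H) -> curve -> C.
Variable corr : correlators.

(* <<fpclass s psi^k>>(t) for t(psi) = \sum_(n <= N) (row n t) psi^n *)
Definition bracket_term N (t : 'M[C]_(N.+1, #|sector Z|)) (s : sector Z) (k : nat)
    (b : curve) (m : nat) : C :=
  (m`!%:R)^-1 * \sum_(f : {ffun 'I_m -> 'I_N.+1})
    corr ((k, fpclass R s) :: [seq (nat_of_ord (f l), row (f l) t) | l <- enum 'I_m]) b.

Definition bracket N (t : 'M[C]_(N.+1, #|sector Z|)) s k : C :=
  tsum (fun b => tsum (bracket_term t s k b)).

Definition bracket_cvg N (t : 'M[C]_(N.+1, #|sector Z|)) : Prop :=
  forall s k, (forall b, tsummable (bracket_term t s k b)) /\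
    tsummable (fun b => tsum (bracket_term t s k b)).

(* z 1 + t(-z) + \sum_(s, k) c s k (dual class of s) z^(-k-1).  With
   c = bracket t these are the points of Givental's cone; the variable z is the
   negative of the one of the convention in which the dilaton shift is
   q(z) = t(z) - z 1, so that J(tau, z), and not J(tau, -z), is on the cone. *)
Definition cone_point N (t : 'M[C]_(N.+1, #|sector Z|)) (c : sector Z -> nat -> C)
    : givental R Z :=
  \row_l laurent_of N.+1 (fun n => match n with
    | Posz k => (if k == 1%N then unit_class R Z 0 l else 0)
        + (-1) ^+ k * (if (k <= N)%N then t (inord k) l else 0)
    | Negz k => \sum_s c s k * dual u nu s 0 l
    end).

(* z 1 + tau + \sum_(s, k) c s k (dual class of s) z^(-k-1) *)
Definition J_series (tau : H) (c : sector Z -> nat -> C) : givental R Z :=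
  \row_l laurent_of 1 (fun n => match n with
    | Posz 0 => tau 0 l
    | Posz k => if k == 1%N then unit_class R Z 0 l else 0
    | Negz k => \sum_s c s k * dual u nu s 0 l
    end).

Definition J_function (tau : H) : givental R Z :=
  J_series tau (bracket (N := 0) tau).

(** ** The extended I-function and the mirror map *)

(* The box vector of e is \sum_i (ext_coef e i) ray_i. *)
Definition ext_coef (e : twist Z) (i : 'I_(nray Z)) : rat :=
  \sum_(j | cone (pt (val e)) j == i) frac (val e) j.

Definition ext_degree (d : curve) (k : {ffun twist Z -> nat}) (i : 'I_(nray Z)) : rat :=
  d 0 i - \sum_e (k e)%:R * ext_coef e i.

(* \prod_(a <= 0, <a> = <l>) (c + a z) / \prod_(a <= l, <a> = <l>) (c + a z) *)
Definition modification (c : C) (l : rat) (z : C) : C :=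
  match Num.ceil l with
  | Posz m => \prod_(n < m) (c + ratr (l - n%:R) * z)^-1
  | Negz m => \prod_(n < m.+1) (c + ratr (l + n.+1%:R) * z)
  end.

(* The pairs (d, k) contributing to the restriction of the I-function to s. *)
Definition I_index (s : sector Z) (d : curve) (k : {ffun twist Z -> nat}) : Prop :=
  [/\ effective d, forall i, i \notin verts (pt s) -> ext_degree d k i \is a Num.int
    & forall j, ext_degree d k (cone (pt s) j) + frac s j \is a Num.int].

Definition pair_curve (d : curve) (t : 'rV[C]_(nray Z)) : C := \sum_i ratr (d 0 i) * t 0 i.

Definition I_term (t : 'rV[C]_(nray Z)) (x : 'rV[C]_#|twist Z|) (s : sector Z) (z : C)
    (dk : curve * {ffun twist Z -> nat}) : C :=
  if `[< I_index s dk.1 dk.2 >] then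
    cexp (pair_curve dk.1 t) * (\prod_e x 0 (enum_rank e) ^+ dk.2 e)
    * (\prod_i modification (divisor_at u nu (pt s) i) (ext_degree dk.1 dk.2 i) z)
    * (\prod_e ((dk.2 e)`!%:R * z ^+ dk.2 e)^-1)
  else 0.

(* The extended I-function of Coates, Corti, Iritani and Tseng: t_i are
   logarithmic coordinates dual to the toric divisors, and x_e are the
   coordinates of the age one twisted sectors. *)
Definition I_function (t : 'rV[C]_(nray Z)) (x : 'rV[C]_#|twist Z|) : givental R Z :=
  \row_l let s := enum_val l in expansion (fun z =>
    z * cexp ((\sum_i t 0 i * divisor_at u nu (pt s) i) / z)
      * tsum (I_term t x s z)).

Definition mirror_map (t : 'rV[C]_(nray Z)) (x : 'rV[C]_#|twist Z|) : H :=
  \row_l I_function t x 0 l 0.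

(* A neighbourhood of the large radius point. *)
Definition large_radius (M eps : R) (t : 'rV[C]_(nray Z)) (x : 'rV[C]_#|twist Z|) : Prop :=
  (forall d, effective d -> reC (pair_curve d t) <= - M * ratr (\sum_i `|d 0 i|)) /\
  (forall e, `|x 0 e| < toC eps).

(** ** Properties of the correlators *)

Definition stable (s : seq (nat * H)) (b : curve) : Prop := (2 < size s)%N \/ b <> 0.

(* The insertion at position l with its psi exponent lowered by one, and its
   class changed by F; zero if the exponent is zero. *)
Definition lowered (F : H -> H) (s : seq (nat * H)) (l : nat) (b : curve) : C :=
  match nth (0%N, 0) s l with
  | (k.+1, v) => corr (set_nth (0%N, 0) s l (k, F v)) b
  | (0%N, _) => 0
  end.

(* The moduli of stable maps are not constructed: what is recorded is that the
   correlators satisfy the fundamental relations of a genus zero equivariant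
   theory on Z, and the toric mirror theorem, which determines the restriction of
   the J-function to Delta_Z. *)
Record GW_theory : Prop := {
  GW_linear : forall s1 s2 k a v w b,
    corr (s1 ++ (k, a *: v + w) :: s2) b
    = a * corr (s1 ++ (k, v) :: s2) b + corr (s1 ++ (k, w) :: s2) b;
  GW_symmetric : forall s s' b, perm_eq s s' -> corr s b = corr s' b;
  GW_effective : forall s b, ~ effective b -> corr s b = 0;
  GW_unstable : forall s, (size s <= 2)%N -> corr s 0 = 0;
  GW_pairing : forall v w,
    corr [:: (0%N, unit_class R Z); (0%N, v); (0%N, w)] 0 = pairing u nu v w;
  GW_string : forall s b, stable s b ->
    corr ((0%N, unit_class R Z) :: s) b = \sum_(l < size s) lowered id s l b;
  GW_dilaton : forall s b, stable s b ->
    corr ((1%N, unit_class R Z) :: s) b = ((size s)%:R - 2) * corr s b;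
  GW_divisor : forall i s b, stable s b ->
    corr ((0%N, divisor u nu i) :: s) b
    = ratr (b 0 i) * corr s b + \sum_(l < size s) lowered (mul_divisor u nu i) s l b;
  GW_recursion : forall k v x y s b,
    corr ((k.+1, v) :: x :: y :: s) b
    = \sum_(b' \in [set: curve]) \sum_(m : (size s).-tuple bool) \sum_(a : sector Z)
        corr [:: (k, v), (0%N, fpclass R a) & mask m s] b'
        * corr [:: (0%N, dual u nu a), x, y & mask (map negb m) s] (b - b');
  GW_mirror : exists M eps : R, 0 < eps /\ forall t x, large_radius M eps t x ->
    bracket_cvg (N := 0) (mirror_map t x) /\
    J_function (mirror_map t x) = I_function t x }.

End Correlators.

(* A space Z together with its equivariant Gromov-Witten theory and a choice of
   a basis of Delta_Z starting with the unit. *)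
Record target (R : realType) (h : 'cV[int]_3) (u : 'rV[int]_3) (nu : Cx R) := Target {
  fan :> stacky_fan;
  fan_CY3 : toric_CY3 fan h;
  fan_fixed : isolated_fixed fan u;
  gw : correlators R fan;
  gwP : GW_theory u nu gw;
  rk : nat;
  basis : rk.+1.-tuple (coh R fan);
  basisP : basis_of (small_space fan u nu) basis;
  basis_unit : basis`_0 = unit_class R fan }.

Arguments gw {R h u nu} t.

Section Targets.
Variables (R : realType) (h : 'cV[int]_3) (u : 'rV[int]_3) (nu : Cx R).
Local Notation C := (Cx R).
Local Notation target := (target h u nu).
Implicit Types X Y Z : target.

(* coordinates on Delta_Z *)
Definition small_coord Z := 'rV[C]_(rk Z).+1.
Definition small Z (tau : small_coord Z) : coh R Z := \sum_l tau 0 l *: (basis Z)`_l.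

Definition small_bracket Z (s : sector Z) k (tau : small_coord Z) : C :=
  bracket (N := 0) (gw Z) (small tau) s k.
Definition big_bracket Z (s : sector Z) k (tau : coh R Z) : C :=
  bracket (N := 0) (gw Z) tau s k.

Definition J Z (tau : coh R Z) : givental R Z := J_function u nu (gw Z) tau.

(** ** Scaling factors *)

Definition zeta Z i : C := coord (basis Z) ord0 (divisor u nu i).

(* `|q|, for an integer q *)
Definition abs_nat (q : rat) : nat := `|Num.floor q|%N.

(* b ranges over the curve classes with integral intersection numbers; those are
   zero on the extra coordinates of a GIT presentation, whose class vanishes. *)
Definition log_h_term Z (t : 'rV[C]_(nray Z)) (b : 'rV[rat]_(nray Z)) : C :=
  if `[< effective b /\ forall i, b 0 i \is a Num.int >] then
    cexp (pair_curve b t)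
    * (\prod_(i | b 0 i < 0) ((-1) ^+ abs_nat (b 0 i) * (abs_nat (b 0 i))`!%:R))
    / (\prod_(i | 0 < b 0 i) (abs_nat (b 0 i))`!%:R)
    * \sum_(i | b 0 i < 0) (- zeta i / ratr (b 0 i))
  else 0.
Definition log_h_at Z (t : 'rV[C]_(nray Z)) : C := tsum (@log_h_term Z t).

(* exp (l / z) *)
Definition exp_over_z (l : C) : laurent C :=
  laurent_of 0 (fun n => match n with
    | Posz 0 => 1 | Posz _ => 0 | Negz k => l ^+ k.+1 / (k.+1)`!%:R end).

(* V is a neighbourhood of large radius on which everything converges and
   a = (log of the Kaehler part, orbifold part) is the inverse mirror map. *)
Definition large_radius_chart Z (V : set (small_coord Z))
    (a : small_coord Z -> 'rV[C]_(nray Z) * 'rV[C]_#|twist Z|) : Prop :=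
  [/\ open V /\ connected V,
      exists M eps : R, 0 < eps /\ forall (t : 'rV[C]_(nray Z)) (x : 'rV[C]_#|twist Z|),
        large_radius M eps t x ->
        forall tau : small_coord Z,
          small tau = \sum_i t 0 i *: divisor u nu i
            + \sum_e x 0 (enum_rank e) *: twisted_class R e -> V tau,
      forall tau, V tau -> bracket_cvg (N := 0) (gw Z) (small tau),
      forall tau, V tau -> tsummable (@log_h_term Z (a tau).1)
    & [/\ holomorphic_on V (fst \o a), holomorphic_on V (snd \o a),
          forall tau, V tau -> mirror_map u nu (a tau).1 (a tau).2 = small tau
        & exists M eps : R, [/\ 0 < eps,
            forall tau, V tau -> large_radius M eps (a tau).1 (a tau).2
          & forall (t t' : 'rV[C]_(nray Z)) (x x' : 'rV[C]_#|twist Z|),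
              large_radius M eps t x -> large_radius M eps t' x' ->
              mirror_map u nu t x = mirror_map u nu t' x' ->
              x = x' /\ forall d, effective d -> pair_curve d t = pair_curve d t']]].

(* log of h_Z as a function on the chart *)
Definition log_h Z (a : small_coord Z -> 'rV[C]_(nray Z) * 'rV[C]_#|twist Z|)
    (tau : small_coord Z) : C := log_h_at (a tau).1.

(** ** The closed crepant resolution conjecture *)

Definition symplectic_iso X Y (U : {linear givental R X -> givental R Y}) : Prop :=
  bijective U /\ forall f g, omega u nu (U f) (U g) = omega u nu f g.

(* v as a constant polynomial in H[z] *)
Definition const_poly (Z : stacky_fan) N (v : coh R Z) : 'M[C]_(N.+1, #|sector Z|) :=
  \matrix_(k, l) if k == ord0 then v 0 l else 0.

Definition cone_on Z (D : forall N, set 'M[C]_(N.+1, #|sector Z|))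
    (c : forall N, sector Z -> nat -> 'M[C]_(N.+1, #|sector Z|) -> C) : set (givental R Z) :=
  [set f | exists N (t : 'M[C]_(N.+1, #|sector Z|)),
     D N t /\ f = cone_point u nu t (fun s k => c N s k t)].

(* The cone of X over a neighbourhood of the chart V, and the analytic
   continuation of the cone of Y along rho, are matched by U. *)
Definition closed_CRC X Y (V : set (small_coord X)) (rho : R -> small_coord Y)
    (U : {linear givental R X -> givental R Y}) : Prop :=
  symplectic_iso U /\
  exists (DX : forall N, set 'M[C]_(N.+1, #|sector X|))
    (DY : forall N, set 'M[C]_(N.+1, #|sector Y|))
    (cY : forall N, sector Y -> nat -> 'M[C]_(N.+1, #|sector Y|) -> C),
  [/\ forall N, [/\ open (DX N), forall tau, V tau -> DX N (const_poly N (small tau))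
        & forall t, DX N t -> bracket_cvg (gw X) t],
      forall N, \forall t \near const_poly N (small (rho 0)), bracket_cvg (gw Y) t,
      forall N s k, continuation (fun r => const_poly N (small (rho r)))
        (fun t => bracket (gw Y) t s k) (DY N) (cY N s k)
    & U @` cone_on DX (fun N s k t => bracket (gw X) t s k) = cone_on DY cY].

(** ** Aganagic-Vafa branes and the disk potential *)

(* A two-dimensional cone (the torus invariant line) and an orientation (true =
   positive) at each adjacent fixed point. *)
Definition brane (Z : stacky_fan) := ({set 'I_(nray Z)} * {ffun 'I_(npt Z) -> bool})%type.

(* The isotropy group of p is cyclic, acting with weights m. *)
Definition cyclic_at (Z : stacky_fan) (p : 'I_(npt Z)) (m : 'I_3 -> nat) : Prop :=
  let f k j : rat := ((k * m j) %% isotropy p)%N%:R / (isotropy p)%:R in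
  (forall k, exists s : sector Z, pt s = p /\ forall j, frac s j = f k j) /\
  (forall s : sector Z, pt s = p -> exists k, forall j, frac s j = f k j).

Definition is_brane (Z : stacky_fan) (L : brane Z) : Prop :=
  [/\ #|L.1| = 2%N, exists p : 'I_(npt Z), L.1 \subset verts p
    & forall p : 'I_(npt Z), L.1 \subset verts p -> exists m, cyclic_at p m].

(* pi / (w1 r sin(pi (f3 - w3/z))) * 1 / (z^-(f1+f2+f3) \prod_i Gamma(1 - f_i + w_i/z));
   the sum of the f_i is an integer *)
Definition disk_factor (Z : stacky_fan) (s : sector Z) (j1 j3 : 'I_3) : laurent C :=
  let w j := weight u nu (pt s) j in
  expansion (fun z =>
    toC pi / (w j1 * (isotropy (pt s))%:R
              * csin (toC pi * (ratr (frac s j3) - w j3 / z)))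
    * (z ^ (- Num.floor (age s))
       * \prod_j cGamma (1 - ratr (frac s j) + w j / z))^-1).

(* The first axis is the ray of the cone which is not on the brane; then 1, 2, 3
   is the cyclic order of the cone, with 2 and 3 exchanged if the orientation is
   negative. *)
Definition disk_coef (Z : stacky_fan) (L : brane Z) (s : sector Z) : laurent C :=
  if L.1 \subset verts (pt s) then
    \sum_(j | cone (pt s) j \notin L.1)
      disk_factor s j (if L.2 (pt s) then j + 2 else j + 1)
  else 0.

Definition disk_mx (Z : stacky_fan) (L : brane Z) : 'M[laurent C]_#|sector Z| :=
  \matrix_(k, l) (disk_coef L (enum_val k) * laurent_const (dual u nu (enum_val k) 0 l)).

Definition disk_endo (Z : stacky_fan) (Ls : seq (brane Z)) (f : givental R Z)
    : givental R Z := \sum_(L <- Ls) f *m disk_mx L.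

Definition disk_potential Z (Ls : seq (brane Z)) (tau : coh R Z) : givental R Z :=
  disk_endo Ls (J tau).

(* The proper transform: the torus invariant lines of Y whose cone is in the
   cone of L, oriented as L. *)
Definition transform1 (X Y : stacky_fan) (L : brane X) : seq (brane Y) :=
  let face (e : {set 'I_(nray Y)}) :=
    [&& #|e| == 2%N, [exists q : 'I_(npt Y), e \subset verts q]
      & [forall i in e, `[< in_cone L.1 (qray i) >]]] in
  let over (q : 'I_(npt Y)) (p : 'I_(npt X)) :=
    [forall j : 'I_3, `[< in_cone (verts p) (qray (cone q j)) >]] in
  [seq (e, [ffun q => oapp L.2 false [pick p | over q p]]) | e <- enum face].

Definition transform (X Y : stacky_fan) (Ls : seq (brane X)) : seq (brane Y) :=
  flatten [seq transform1 Y L | L <- Ls].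

(** ** Identifications of quantum parameters *)

(* I : Delta_X -> Delta_Y, biholomorphic from V onto W, where lhY and cY are the
   continuations of log h_Y and of the J-function of Y. *)
Definition small_identification X Y (U : {linear givental R X -> givental R Y})
    (V : set (small_coord X)) (W : set (small_coord Y)) (lhX : small_coord X -> C)
    (lhY : small_coord Y -> C) (cY : sector Y -> nat -> small_coord Y -> C)
    (I : small_coord X -> small_coord Y) : Prop :=
  [/\ holomorphic_on V I, {in V &, injective I}, I @` V = W
    & forall tau, V tau ->
        exp_over_z (lhY (I tau)) *: J_series u nu (small (I tau)) (fun s k => cY s k (I tau))
        = U (exp_over_z (lhX tau) *: J (small tau))].

Definition affine_iso (H H' : lmodType C) (F : H -> H') : Prop :=
  bijective F /\ exists (A : {linear H -> H'}) (b : H'), forall v, F v = A v + b.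

Definition big_identification X Y (U : {linear givental R X -> givental R Y})
    (V : set (small_coord X)) (I : small_coord X -> small_coord Y)
    (rho : R -> small_coord Y) (Vbig : set (coh R X))
    (cY : sector Y -> nat -> coh R Y -> C) (Ibig : coh R X -> coh R Y) : Prop :=
  [/\ [/\ open Vbig, connected Vbig, forall tau, V tau -> Vbig (small tau),
          forall v, Vbig v -> bracket_cvg (N := 0) (gw X) v
        & \forall v \near small (rho 0), bracket_cvg (N := 0) (gw Y) v],
      affine_iso Ibig,
      forall tau, V tau -> Ibig (small tau) = small (I tau),
      forall s k, continuation (fun r => small (rho r)) (big_bracket s k)
        (Ibig @` Vbig) (cY s k)
    & forall v, Vbig v ->
        J_series u nu (Ibig v) (fun s k => cY s k (Ibig v)) = U (J v)].

(* Ft is, coefficientwise, the analytic continuation of F along rho. *)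
Definition series_continuation Y (V : normedModType C) (rho : R -> V)
    (F : V -> givental R Y) (W : set V) (Ft : V -> givental R Y) : Prop :=
  forall l (n : int), continuation rho (fun tau => F tau 0 l n) W (fun tau => Ft tau 0 l n).

End Targets.

(* Main.v *)
Require Import Defs.
From HB Require Import structures.
From mathcomp Require Import all_boot all_order all_algebra finmap.
From mathcomp Require Import all_classical all_reals all_analysis.
Import Order.TTheory GRing.Theory Num.Theory numFieldNormedType.Exports.
Local Open Scope classical_set_scope.
Local Open Scope ring_scope.

(** The disk potential is a linear image of the J-function, and this forces both
  identities.  If Jt denotes the continued J-function of Y, the identification
  of small parameters says

    exp (lhY (I tau) / z) Jt (I tau) = U (exp (log_h aX tau / z) J (tau)).

  Applying the disk endomorphism D_Y of Y, using D_Y U = O D_X on the right, and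
  pulling the scalars exp (. / z) through D_X, D_Y and O, all of which are linear
  over Laurent series, gives the first identity with F = D_Y Jt.  The Hard
  Lefschetz case is the same computation with trivial scalars.

  What has to be justified is that F really is the continuation of the disk
  potential of Y, coefficient by coefficient in z.  Each coefficient of J is a
  constant, a coordinate of the parameter, or a finite linear combination of
  brackets, so it continues along the path (continuation_J_series).  The
  endomorphism D_Y does not depend on the parameter, but its entries are infinite
  series in 1/z.  Since J has degree at most 1 in z for every parameter, each
  coefficient of D_Y J is nevertheless a linear combination of finitely many
  coefficients of J, the same ones for all parameters, and finite linear
  combinations continue term by term (continuation_coef_mul,
  continuation_disk_J). *)

(** * Coefficients of Laurent series in 1/z *)

Section LaurentCoefficients.
Variable K : comNzRingType.

Lemma laurent_coef_sum (I : Type) (s : seq I) (f : I -> laurent K) n :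
  coef (\sum_(i <- s) f i) n = \sum_(i <- s) f i n.
Proof.
apply: (big_morph (fun f : laurent K => f n)) => //=.
by rewrite !if_same.
Qed.

(** Only pairs of degrees at most a and at most b contribute, and m + 1 of them
  add up to a + b - m; the index range thus depends on f and g through the
  bounds a and b alone. *)
Lemma coef_mul_sum (f g : laurent K) (a b : int) (m : nat) :
  top_le a f -> top_le b g ->
  (f * g) (a + b - m%:Z) = \sum_(i < m.+1) f (a - i%:Z) * g (b - (m - i)%N%:Z).
Proof.
move=> fa gb; rewrite [LHS](mul_coefE fa gb (ltnSn m)) coefM.
by apply: eq_bigr => i _; rewrite !coef_poly ltn_ord ltnS leq_subr.
Qed.

End LaurentCoefficients.

(** * Continuation along a path *)

Section Continuation.
Variables (R : realType) (V : normedModType (Cx R)) (rho : R -> V) (W : set V).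
Implicit Types f g : V -> Cx R.

(** Every germ along the path can be taken to be f itself. *)
Lemma continuation_entire f :
  open W -> connected W -> W (rho 1) ->
  (forall x, differentiable (f : V -> (Cx R)^o) x) -> continuation rho f W f.
Proof.
move=> oW cW W1 df; split=> //; exists (fun=> f); split=> [r _|r _||].
- exact: nearW.
- near=> r' => _; exact: nearW.
- exact: nearW.
- exact: nearW.
Unshelve. all: by end_near. Qed.

Lemma eq_continuation f g ft gt :
  f =1 g -> ft =1 gt -> continuation rho g W gt -> continuation rho f W ft.
Proof. by move=> /funext -> /funext ->. Qed.

Lemma continuation_add f g ft gt :
  continuation rho f W ft -> continuation rho g W gt ->
  continuation rho (fun x => f x + g x) W (fun x => ft x + gt x).
Proof.
move=> [oW cW W1 dft [F [Fdiff Fglue F0 F1]]] [_ _ _ dgt [G [Gdiff Gglue G0 G1]]].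
split; [exact: oW|exact: cW|exact: W1| |].
  by move=> x Wx; apply: differentiableD; [exact: dft|exact: dgt].
exists (fun r x => F r x + G r x); split=> [r r01|r r01||].
- by apply: filterS2 (Fdiff r r01) (Gdiff r r01) => y; apply: differentiableD.
- apply: filterS2 (Fglue r r01) (Gglue r r01) => r' Fr Gr r'01.
  by apply: filterS2 (Fr r'01) (Gr r'01) => y -> ->.
- by apply: filterS2 F0 G0 => y -> ->.
- by apply: filterS2 F1 G1 => y -> ->.
Qed.

Lemma continuation_scale (k : Cx R) f ft :
  continuation rho f W ft ->
  continuation rho (fun x => f x * k) W (fun x => ft x * k).
Proof.
have scale_diff (g : V -> Cx R) x : differentiable (g : V -> (Cx R)^o) x ->
    differentiable ((fun y => g y * k) : V -> (Cx R)^o) x.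
  move=> dg; rewrite (_ : (fun y => g y * k) = k *: (g : V -> (Cx R)^o)).
    exact: differentiableZ.
  by apply/funext => y; rewrite mulrC.
move=> [oW cW W1 dft [F [Fdiff Fglue F0 F1]]].
split; [exact: oW|exact: cW|exact: W1| |].
  by move=> x Wx; apply: scale_diff; exact: dft.
exists (fun r x => F r x * k); split=> [r r01|r r01||].
- by apply: filterS (Fdiff r r01) => y; apply: scale_diff.
- apply: filterS (Fglue r r01) => r' Fr r'01.
  by apply: filterS (Fr r'01) => y ->.
- by apply: filterS F0 => y ->.
- by apply: filterS F1 => y ->.
Qed.

Lemma continuation_sum (I : Type) (s : seq I) (f ft : I -> V -> Cx R) :
  open W -> connected W -> W (rho 1) ->
  (forall i, continuation rho (f i) W (ft i)) ->
  continuation rho (fun x => \sum_(i <- s) f i x) W (fun x => \sum_(i <- s) ft i x).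
Proof.
move=> oW cW W1 fft; elim: s => [|i s IHs].
  apply: eq_continuation => [x|x|]; [exact: big_nil|exact: big_nil|].
  by apply: continuation_entire => // x; exact: differentiable_cst.
apply: eq_continuation => [x|x|]; [exact: big_cons|exact: big_cons|].
exact: continuation_add.
Qed.

(** A common bound a on the degrees makes the coefficient of z^n in the product a
  linear combination of the same finitely many coefficients of S x for all x. *)
Lemma continuation_coef_mul (S St : V -> laurent (Cx R)) (g : laurent (Cx R)) (a : int) :
  open W -> connected W -> W (rho 1) ->
  (forall x, top_le a (S x)) -> (forall x, top_le a (St x)) ->
  (forall n, continuation rho (fun x => S x n) W (fun x => St x n)) ->
  forall n, continuation rho (fun x => (S x * g) n) W (fun x => (St x * g) n).
Proof.
move=> oW cW W1 Sa Sta SSt n; have [b gb] := laurent_top g.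
have [abn|[m ->]] := top_or_sub (a + b) n.
  apply: eq_continuation => [x|x|].
  - exact: mul_coef_top (Sa x) gb n abn.
  - exact: mul_coef_top (Sta x) gb n abn.
  by apply: continuation_entire => // x; exact: differentiable_cst.
apply: eq_continuation => [x|x|].
- exact: coef_mul_sum (Sa x) gb.
- exact: coef_mul_sum (Sta x) gb.
by apply: continuation_sum => // i; apply: continuation_scale.
Qed.

End Continuation.

(** * The disk endomorphism *)

Section DiskEndomorphism.
Variables (R : realType) (Z : stacky_fan) (u : 'rV[int]_3) (nu : Cx R).
Implicit Types Ls : seq (brane Z).

Lemma disk_endoZ Ls (a : laurent (Cx R)) (f : givental R Z) :
  disk_endo u nu Ls (a *: f) = a *: disk_endo u nu Ls f.
Proof. by rewrite scaler_sumr; apply: eq_bigr => b _; rewrite scalemxAl. Qed.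

Lemma top_J_series (tau : coh R Z) c l : top_le 1 (J_series u nu tau c 0 l).
Proof. by move=> n n1; rewrite mxE /= leNgt n1. Qed.

Lemma continuation_J_series
    (V : normedModType (Cx R)) (rho : R -> V) (W : set V)
    (t : V -> coh R Z) (c ct : sector Z -> nat -> V -> Cx R) :
  open W -> connected W -> W (rho 1) ->
  (forall l x, differentiable ((fun y => t y 0 l) : V -> (Cx R)^o) x) ->
  (forall s k, continuation rho (c s k) W (ct s k)) ->
  forall l n, continuation rho
    (fun x => J_series u nu (t x) (fun s k => c s k x) 0 l n) W
    (fun x => J_series u nu (t x) (fun s k => ct s k x) 0 l n).
Proof.
move=> oW cW W1 dt cct l m.
apply: eq_continuation => [x|x|].
- by rewrite mxE /=; reflexivity.
- by rewrite mxE /=; reflexivity.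
case: (m <= 1); last by apply: continuation_entire => // x; exact: differentiable_cst.
case: m => [[|k]|k].
- exact: continuation_entire.
- by apply: continuation_entire => // x; exact: differentiable_cst.
- by apply: continuation_sum => // s; exact: continuation_scale.
Qed.

(** Summing over branes and sectors is harmless; the products with the entries
  of the disk matrices are covered by the degree bound on J. *)
Lemma continuation_disk_J
    (V : normedModType (Cx R)) (rho : R -> V) (W : set V)
    (t : V -> coh R Z) (c ct : sector Z -> nat -> V -> Cx R) Ls :
  open W -> connected W -> W (rho 1) ->
  (forall l x, differentiable ((fun y => t y 0 l) : V -> (Cx R)^o) x) ->
  (forall s k, continuation rho (c s k) W (ct s k)) ->
  forall l n, continuation rho
    (fun x => disk_endo u nu Ls (J_series u nu (t x) (fun s k => c s k x)) 0 l n) W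
    (fun x => disk_endo u nu Ls (J_series u nu (t x) (fun s k => ct s k x)) 0 l n).
Proof.
move=> oW cW W1 dt cct l n.
have disk_coefE (f : givental R Z) :
    disk_endo u nu Ls f 0 l n
    = \sum_(b <- Ls) \sum_a (f 0 a * disk_mx u nu b a l) n.
  rewrite /disk_endo summxE laurent_coef_sum; apply: eq_bigr => b _.
  by rewrite mxE laurent_coef_sum.
apply: eq_continuation => [x|x|]; [exact: disk_coefE|exact: disk_coefE|].
apply: continuation_sum => // b; apply: continuation_sum => // a.
apply: (continuation_coef_mul _ _ _ _
  (fun x => J_series u nu (t x) (fun s k => c s k x) 0 a)
  (fun x => J_series u nu (t x) (fun s k => ct s k x) 0 a) _ 1) => //.
- by move=> x; exact: top_J_series.
- by move=> x; exact: top_J_series.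
- by move=> m; exact: continuation_J_series.
Qed.

End DiskEndomorphism.

(** * The continued disk potential *)

(** A point of Delta_Z depends linearly on its coordinates in the chosen basis. *)
Lemma differentiable_small (R : realType) (h : 'cV[int]_3) (u : 'rV[int]_3) (nu : Cx R)
    (Z : target h u nu) l x :
  differentiable ((fun y : small_coord Z => small y 0 l) : _ -> (Cx R)^o) x.
Proof.
rewrite (_ : (fun _ => _) =
    \sum_(i < (rk Z).+1) ((Defs.basis Z)`_i 0 l
            *: ((fun y : small_coord Z => y 0 i) : _ -> (Cx R)^o))).
  by apply: differentiable_sum => i; apply: differentiableZ; exact: differentiable_coord.
apply/funext => y; rewrite /small summxE fct_sumE.
by apply: eq_bigr => i _; rewrite mxE mulrC.
Qed.

Theorem proposition3p6
  (R : realType) (h : 'cV[int]_3) (u : 'rV[int]_3) (nu : Cx R)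
  (u_CY : u *m h = 0) (nu_neq0 : nu != 0)
  (X Y : target h u nu) (XY : crepant_resolution h X Y)
  (VX : set (small_coord X)) (aX : small_coord X -> 'rV[Cx R]_(nray X) * 'rV[Cx R]_#|twist X|)
  (chartX : large_radius_chart VX aX)
  (VY : set (small_coord Y)) (aY : small_coord Y -> 'rV[Cx R]_(nray Y) * 'rV[Cx R]_#|twist Y|)
  (chartY : large_radius_chart VY aY)
  (rho : R -> small_coord Y) (rho_path : is_path rho) (rho0 : VY (rho 0))
  (U : {linear givental R X -> givental R Y}) (CRC : closed_CRC VX rho U)
  (W : set (small_coord Y))
  (cY : sector Y -> nat -> small_coord Y -> Cx R)
  (J_cont : forall s k, continuation rho (small_bracket s k) W (cY s k))
  (lhY : small_coord Y -> Cx R) (h_cont : continuation rho (log_h aY) W lhY)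
  (I : small_coord X -> small_coord Y)
  (I_small : small_identification U VX W (log_h aX) lhY cY I)
  (L : seq (brane X)) (L_brane : forall b, b \in L -> is_brane b)
  (O : {linear givental R X -> givental R Y})
  (O_disk : forall f : givental R X,
     disk_endo u nu (transform Y L) (U f) = O (disk_endo u nu L f)) :
  (exists F : small_coord Y -> givental R Y,
     series_continuation rho (fun tau => disk_potential (transform Y L) (small tau)) W F /\
     forall tau, VX tau ->
       exp_over_z (lhY (I tau)) *: F (I tau)
       = exp_over_z (log_h aX tau) *: O (disk_potential L (small tau)))
  /\
  (hard_lefschetz X ->
   forall (Vbig : set (coh R X)) (cYbig : sector Y -> nat -> coh R Y -> Cx R)
     (Ibig : coh R X -> coh R Y),
   big_identification U VX I rho Vbig cYbig Ibig ->
   exists F : coh R Y -> givental R Y,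
     series_continuation (fun r => small (rho r)) (disk_potential (transform Y L))
       (Ibig @` Vbig) F /\
     forall tau, Vbig tau -> F (Ibig tau) = O (disk_potential L tau)).
Proof.
have [oW cW W1 _ _] := h_cont; have [_ _ _ I_J] := I_small; split.
  exists (fun tau => disk_endo u nu (transform Y L)
    (J_series u nu (small tau) (fun s k => cY s k tau))); split.
    by move=> l n; apply: continuation_disk_J => // *; exact: differentiable_small.
  move=> tau Vtau; rewrite -disk_endoZ I_J// O_disk.
  by rewrite disk_endoZ linearZ.
move=> _ Vbig cYbig Ibig [_ _ _ cbig Ibig_J].
exists (fun tau => disk_endo u nu (transform Y L)
  (J_series u nu tau (fun s k => cYbig s k tau))); split.
  (* An index l names a sector of Y, whose brackets continue over Ibig @` Vbig;
     this supplies the topological conditions on that domain. *)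
  move=> l n; have [oV cV V1 _ _] := cbig (enum_val l) 0%N.
  by apply: (continuation_disk_J _ _ _ _ _ _ _ id) => // *; exact: differentiable_coord.
by move=> tau Vtau; rewrite Ibig_J// O_disk.
Qed.
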